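(* Let $(\sigma_n)_{n\ge1}$ be a conjugation invariant sequence of random permutations. Then for any $\varepsilon>0$, $$\mathbb{P}\left(\mathrm{LIS}(\sigma_n)>(2\sqrt{13}-6-\varepsilon)\sqrt n\right)\xrightarrow[n\to\infty]{}1.$$ Consequently, $$\liminf_{n\to\infty}\frac{\mathbb{E}(\mathrm{LIS}(\sigma_n))}{\sqrt n}\ge 2\sqrt{13}-6.$$
   Context: $\mathfrak{S}_n$ is the group of permutations of $\{1,\dots,n\}$. A sequence of random permutations $(\sigma_n)_{n\ge1}$ is conjugation invariant if, for all $n\ge1$, $\sigma_n$ takes values in $\mathfrak{S}_n$ and for every $\sigma\in\mathfrak{S}_n$, $\sigma^{-1}\sigma_n\sigma$ has the same distribution as $\sigma_n$. $\mathrm{LIS}(\sigma)$ is the maximal $k$ such that there are $i_1<\dots<i_k$ with $\sigma(i_1)<\dots<\sigma(i_k)$. *)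

(* Defs.v *)
From HB Require Import structures.
From mathcomp Require Import all_boot all_order all_algebra all_fingroup.
From mathcomp Require Import all_classical all_reals all_analysis.
Set Implicit Arguments.
Unset Strict Implicit.
Unset Printing Implicit Defensive.
Import Order.TTheory GRing.Theory Num.Theory.
Import numFieldNormedType.Exports.
Local Open Scope classical_set_scope.
Local Open Scope ring_scope.

(* Permutations of a finite type carry the discrete sigma-algebra; these
   instances apply to 'S_n, whose elements permute {0, ..., n-1} instead of
   {1, ..., n}. *)
HB.instance Definition _ (T : finType) := isPointed.Build (perm_type T) 1%g.

HB.instance Definition _ (T : finType) :=
  @isMeasurable.Build default_measure_display (perm_type T)
    discrete_measurable discrete_measurable0 discrete_measurableC
    discrete_measurableU.

Definition increasing_subseq (n : nat) (s : 'S_n) (k : nat)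
    (t : k.-tuple 'I_n) : bool :=
  sorted (fun i j : 'I_n => i < j)%N t &&
  sorted (fun i j : 'I_n => s i < s j)%N t.

(* Bounding k by n loses nothing: i_1 < ... < i_k in 'I_n forces k <= n. *)
Definition LIS (n : nat) (s : 'S_n) : nat :=
  \max_(k < n.+1 | [exists t : k.-tuple 'I_n, increasing_subseq s t]) k.

(* The n-th random permutation may live on its own probability space; taking
   T and P constant gives the case of a common one.  The product of 'S_n is
   composition in diagrammatic order, (s * t)%g x = t (s x); since s ranges over
   the whole group, the condition does not depend on this convention.  The
   term of index 0 is the unique element of 'S_0. *)
Definition conjugation_invariant (R : realType) (d : nat -> measure_display)
    (T : forall n, measurableType (d n)) (P : forall n, probability (T n) R)
    (sigma : forall n, {RV (P n) >-> 'S_n}) : Prop :=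
  forall (n : nat) (s : 'S_n), (0 < n)%N ->
    pushforward (P n) (fun w => (s^-1 * sigma n w * s)%g) =
    distribution (P n) (sigma n).

(* Main.v *)
Require Import Defs.
From HB Require Import structures.
From mathcomp Require Import all_boot all_order all_algebra all_fingroup.
From mathcomp Require Import ring lra zify.
From mathcomp Require Import all_classical all_reals all_analysis.
From mathcomp Require Import measurable_realfun.
Set Implicit Arguments.
Unset Strict Implicit.
Unset Printing Implicit Defensive.
Import Order.TTheory GRing.Theory Num.Theory.
Import numFieldNormedType.Exports.
Local Open Scope ring_scope.

(** Since 2 sqrt 13 - 6 < 61 / 50, it is enough to find, with probability
    tending to 1, an increasing subsequence of length 5 / 4 sqrt n.  The proof
    gives every point a random label and reads the permutation in the order of
    the labels; an elementary online selection then finds the subsequence.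

    By conjugation invariance sigma_n has the law of t^-1 * sigma_n * t for any
    random relabelling t independent of it, so one may fix the permutation p
    and randomize t alone [prob_le_of_freq_conj].  An increasing subsequence of
    t^-1 * p * t is a set C of points such that the order of t on C is also the
    order of t on p C [LIS_conj_ge_chain].  The fixed points of p are such a
    set, so p may be assumed to have at most 5 / 4 sqrt n of them.

    Each point a gets an independent uniform label (block, value), with m + 1
    blocks and W values, and t sorts the labels lexicographically.  For
    consecutive blocks k and k + 1, keep the points a such that a is in block k
    and p a in block k + 1: about n / (m + 1)^2 of them.  Because sources and
    targets of these points lie in different blocks, their source values and
    target values behave as independent uniform variables, whatever the cycle
    structure of p.  Moreover, chains found for k = 0, ..., m - 1 concatenate to
    a single chain [LIS_ge_concat], so that a chain of length about
    gamma sqrt n / (m + 1) for each k yields gamma sqrt n m / (m + 1) in total.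

    For one k, scan the points by increasing source value and accept a point
    when its target value exceeds the last accepted one by at most a window w.
    Measuring target values from the last accepted one, cyclically modulo W, is
    a bijection of the set of labellings [rotate_inj]; under it acceptance
    becomes an independent event of probability w / W, and the accepted targets
    increase as long as the total of the accepted increments does not exceed W
    [selected_chain].  The expected number of accepted points is
    n / (m + 1)^2 * w / W and the expected total is w / 2 times this; keeping
    the total below W allows any gamma < sqrt 2.  Both quantities are sums over
    a of g(label a) h(label (p a)), whose variance is small [var_edge_sum], so
    Chebyshev's inequality applies [freq_no_long_chain].  The choice
    gamma = 4 / 3, m = 64 leaves more than 5 / 4 sqrt n
    [freq_LIS_conj_le]. *)

(** * Increasing subsequences as chains of a relabelled permutation *)

Lemma perm_of_key (n : nat) (f : 'I_n -> nat) : injective f ->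
  exists s : 'S_n, forall a b, (s a < s b)%N = (f a < f b)%N.
Proof.
move=> f_inj.
pose below a := [set b | (f b < f a)%N].
have below_lt a : (#|below a| < n)%N.
  rewrite -[X in (_ < X)%N]card_ord -cardsT; apply: proper_card.
  by apply/properP; split; [exact: finset.subsetT | exists a; rewrite !inE ?ltnn].
pose r a := Ordinal (below_lt a).
have r_mono a b : (f a < f b)%N -> (r a < r b)%N.
  move=> ab; apply: proper_card; apply/properP; split.
    by apply/fintype.subsetP => c; rewrite !inE => /ltn_trans; apply.
  by exists a; rewrite !inE ?ltnn.
have r_inj : injective r.
  move=> a b rab; apply: f_inj; case: (ltngtP (f a) (f b)) => // /r_mono;
    by rewrite rab ltnn.
exists (perm r_inj) => a b; rewrite !permE.
case: (ltngtP (f a) (f b)) => [/r_mono //|/r_mono ba|/f_inj->].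
  by rewrite ltnNge ltnW.
by rewrite ltnn.
Qed.

Lemma LIS_ge_chain (n : nat) (s : 'S_n) (C : {set 'I_n}) :
    {in C &, forall a b : 'I_n, (a < b)%N -> (s a < s b)%N} ->
  (#|C| <= LIS s)%N.
Proof.
move=> mono.
have leC : (#|C| < n.+1)%N by rewrite ltnS -[n in (_ <= n)%N]card_ord max_card.
rewrite /LIS; apply: (@leq_bigmax_cond _ _ _ (Ordinal leC)).
apply/existsP; exists (enum_tuple (mem C)); rewrite /increasing_subseq.
have incr : sorted (fun i j : 'I_n => (i < j)%N) (enum C).
  rewrite {1}/enum_mem; apply: sorted_filter; first by move=> a b c; apply: ltn_trans.
  by have := iota_ltn_sorted 0 n; rewrite -val_enum_ord sorted_map enumT.
rewrite incr /=.
apply: (sub_in_sorted (P := mem C)) incr.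
  by move=> a b aC bC; apply: mono.
by apply/allP => a; rewrite mem_enum.
Qed.

(** Conjugating by [t] transports [C] to the positions [t @: C], on which
    [t^-1 * p * t] sends [t a] to [t (p a)]. *)
Lemma LIS_conj_ge_chain (n : nat) (p t : 'S_n) (C : {set 'I_n}) :
    {in C &, forall a b, (t a < t b)%N -> (t (p a) < t (p b))%N} ->
  (#|C| <= LIS (t^-1 * p * t)%g)%N.
Proof.
move=> mono; rewrite -(card_imset (mem C) (@perm_inj _ t)).
apply: LIS_ge_chain => _ _ /imsetP[a aC ->] /imsetP[b bC ->] ab.
by rewrite !permM !permK; apply: mono.
Qed.

(** * Averages over finite types *)

Section FiniteMean.
Variable R : realFieldType.

Definition mean (T : finType) (X : T -> R) : R := (\sum_t X t) / #|T|%:R.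

Lemma meanD (T : finType) (X Y : T -> R) :
  mean (fun t => X t + Y t) = mean X + mean Y.
Proof. by rewrite /mean big_split mulrDl. Qed.

Lemma meanZ (T : finType) (c : R) (X : T -> R) :
  mean (fun t => c * X t) = c * mean X.
Proof. by rewrite /mean -mulr_sumr mulrA. Qed.

Lemma mean_sum (T I : finType) (P : pred I) (X : I -> T -> R) :
  mean (fun t => \sum_(i | P i) X i t) = \sum_(i | P i) mean (X i).
Proof. by rewrite /mean exchange_big mulr_suml. Qed.

Lemma ler_mean (T : finType) (X Y : T -> R) :
  (forall t, X t <= Y t) -> mean X <= mean Y.
Proof.
by move=> XY; apply: ler_wpM2r; rewrite ?invr_ge0 ?ler0n //; apply: ler_sum.
Qed.

Lemma eq_mean (T : finType) (X Y : T -> R) : X =1 Y -> mean X = mean Y.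
Proof. by move=> XY; congr (_ / _); apply: eq_bigr => t _; rewrite XY. Qed.

Lemma mean_cst (T : finType) (c : R) : (0 < #|T|)%N -> mean (fun _ : T => c) = c.
Proof.
move=> T0; rewrite /mean sumr_const -[c *+ _]mulr_natr mulfK //.
by rewrite pnatr_eq0 -lt0n.
Qed.

Lemma mean_ge0 (T : finType) (X : T -> R) : (forall t, 0 <= X t) -> 0 <= mean X.
Proof. by move=> X0; rewrite divr_ge0 ?ler0n ?sumr_ge0. Qed.

Definition freq (T : finType) (P : pred T) : R := mean (fun t => (P t)%:R).

Lemma freq_le (T : finType) (P Q : pred T) :
  (forall t, P t -> Q t) -> freq P <= freq Q.
Proof.
move=> PQ; apply: ler_mean => t; rewrite ler_nat.
by case: (P t) (PQ t) => // ->.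
Qed.

Lemma freq_or (T : finType) (P Q : pred T) :
  freq (fun t => P t || Q t) <= freq P + freq Q.
Proof.
rewrite -meanD; apply: ler_mean => t; rewrite -natrD ler_nat.
by case: (P t); case: (Q t).
Qed.

Lemma freq_exists (T I : finType) (P : I -> pred T) :
  freq (fun t => [exists i, P i t]) <= \sum_i freq (P i).
Proof.
rewrite -mean_sum; apply: ler_mean => t; case: existsP => [[i Pit]|_].
  by rewrite (bigD1 i) //= Pit lerDl sumr_ge0.
by rewrite sumr_ge0.
Qed.

Lemma freq_bij (T : finType) (f : T -> T) (P : pred T) : injective f ->
  freq (fun t => P (f t)) = freq P.
Proof.
by move=> f_inj; rewrite /freq /mean [in RHS](reindex_inj f_inj).
Qed.

Lemma chebyshev_mean (T : finType) (X : T -> R) (c v t : R) (P : pred T) :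
    0 < t -> mean (fun w => (X w - c) ^+ 2) <= v ->
    (forall w, P w -> t <= `|X w - c|) ->
  freq P <= v / t ^+ 2.
Proof.
move=> t0 hv PX; rewrite ler_pdivlMr ?exprn_gt0 // mulrC -meanZ.
apply: le_trans hv; apply: ler_mean => w.
case: (boolP (P w)) => [/PX h|_]; last by rewrite mulr0 sqr_ge0.
by rewrite mulr1 -(real_normK (num_real (X w - c))) lerXn2r ?nnegrE ?(ltW t0).
Qed.

(** Independence of the coordinates of a uniform function: the average of a
    product over distinct coordinates factors. *)
Lemma mean_prod_seq (I L : finType) (F : I -> L -> R) (s : seq I) :
    (0 < #|L|)%N -> uniq s ->
  mean (fun u : {ffun I -> L} => \prod_(i <- s) F i (u i)) =
  \prod_(i <- s) mean (F i).
Proof.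
move=> L0 s_uniq.
have L0' : #|L|%:R != 0 :> R by rewrite pnatr_eq0 -lt0n.
have -> : mean (fun u : {ffun I -> L} => \prod_(i <- s) F i (u i)) =
  mean (fun u : {ffun I -> L} => \prod_i (if i \in s then F i (u i) else 1)).
  by apply: eq_mean => u; rewrite -big_mkcond big_uniq.
rewrite /mean -(bigA_distr_bigA (fun i x => if i \in s then F i x else 1)) /=.
rewrite card_ffun natrX -prodr_const -prodf_div.
rewrite [RHS]big_uniq //= [RHS]big_mkcond; apply: eq_bigr => i _.
by case: ifP => // _; rewrite sumr_const divff.
Qed.

Lemma mean_pair (S T : finType) (F : S -> R) (G : T -> R) :
  mean (fun x : S * T => F x.1 * G x.2) = mean F * mean G.
Proof.
rewrite /mean card_prod natrM [RHS]mulrACA -invfM; congr (_ / _).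
rewrite -(pair_bigA _ (fun x y => F x * G y)) /= mulr_suml.
by apply: eq_bigr => x _; rewrite mulr_sumr.
Qed.

Lemma mean_ord_eq (m k : nat) : (k < m)%N ->
  mean (fun x : 'I_m => (x == k :> nat)%:R) = m%:R^-1 :> R.
Proof.
move=> km; rewrite /mean card_ord (bigD1 (Ordinal km)) //= eqxx big1 ?addr0 ?mul1r //.
by move=> x; rewrite -val_eqE /= => /negPf->.
Qed.

Lemma mean_ord_lt (W w : nat) (F : nat -> R) : (w <= W)%N ->
  mean (fun y : 'I_W => (y < w)%:R * F y) = (\sum_(y < w) F y) / W%:R.
Proof.
move=> wW; rewrite /mean card_ord (big_ord_widen _ _ wW) [in RHS]big_mkcond /=.
by congr (_ / _); apply: eq_bigr => y _; case: ifP; rewrite ?mul1r ?mul0r.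
Qed.

Lemma sum_succ (w : nat) : \sum_(y < w) y.+1%:R = w%:R * (w%:R + 1) / 2 :> R.
Proof.
elim: w => [|w IHw]; first by rewrite big_ord0 !mul0r.
by rewrite big_ord_recr /= IHw -natr1; field.
Qed.

(** * Second moment of a sum over the edges of a permutation *)

Section EdgeSum.
Variables (I L : finType) (p : {perm I}) (g h : L -> R) (B : R).
Hypotheses (L_gt0 : (0 < #|L|)%N) (g01 : forall x, 0 <= g x <= 1)
  (h0B : forall x, 0 <= h x <= B) (gh0 : forall x, g x * h x = 0).

Definition edge_sum (u : {ffun I -> L}) : R := \sum_a g (u a) * h (u (p a)).

Let Y a (u : {ffun I -> L}) : R := g (u a) * h (u (p a)).
Let c := mean g * mean h.
Let N : R := #|[set a | p a != a]|%:R.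

Let Y_ge0 a u : 0 <= Y a u.
Proof.
by rewrite mulr_ge0 //; [case/andP: (g01 (u a)) | case/andP: (h0B (u (p a)))].
Qed.

Let mean_Y a : p a != a -> mean (Y a) = c.
Proof.
move=> pa; pose F i := if i == a then g else h.
have := @mean_prod_seq _ L F [:: a; p a] L_gt0.
rewrite /= inE eq_sym pa => /(_ isT); rewrite !big_cons big_nil mulr1 /F eqxx.
rewrite (negPf pa) /= /c => <-; apply: eq_mean => u.
by rewrite !big_cons big_nil mulr1 eqxx (negPf pa).
Qed.

(** Two edges sharing no endpoint are independent; otherwise [Y a * Y b] is
    bounded by [B * Y a]. *)
Let mean_YY a b : p a != a -> p b != b ->
  mean (fun u => Y a u * Y b u) <=
    c ^+ 2 + B * c * ((b == a)%:R + (b == p a)%:R + (p b == a)%:R).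
Proof.
move=> pa pb.
have c0 : 0 <= c by rewrite -(mean_Y pa); apply: mean_ge0.
have B0 : 0 <= B.
  by case/card_gt0P: L_gt0 => x _; case/andP: (h0B x); apply: le_trans.
have [near|] := boolP [|| b == a, b == p a | p b == a].
  apply: (@le_trans _ _ (B * c)).
    rewrite -(mean_Y pa) -meanZ; apply: ler_mean => u; rewrite mulrC.
    apply: ler_wpM2r => //; case/andP: (g01 (u b)) => g0 g1.
    case/andP: (h0B (u (p b))) => h0 hB.
    by apply: le_trans hB; rewrite ler_piMl.
  apply: ler_wpDl; first exact: sqr_ge0.
  have Bc0 : 0 <= B * c by exact: mulr_ge0.
  rewrite ler_peMr // -!natrD ler1n !addn_gt0 !lt0b.
  by case/or3P: near => ->; rewrite ?orbT.
rewrite !negb_or => /and3P[ba bpa pba].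
have pba' : p b != p a by rewrite (inj_eq perm_inj).
pose F i := if (i == a) || (i == b) then g else h.
have := @mean_prod_seq _ L F [:: a; p a; b; p b] L_gt0.
rewrite /= !inE !negb_or (eq_sym a (p a)) pa (eq_sym a b) ba (eq_sym a (p b)) pba.
rewrite (eq_sym (p a) b) bpa (eq_sym (p a) (p b)) pba' (eq_sym b (p b)) pb.
move=> /(_ isT); rewrite !big_cons !big_nil /F !eqxx orbT /=.
rewrite (negPf pa) (negPf pb) (negPf pba) (eq_sym (p a) b) (negPf bpa) /=.
move=> E; rewrite le_eqVlt; apply/orP; left.
rewrite (negPf ba) !addr0 mulr0 addr0.
have -> : c ^+ 2 = mean g * (mean h * (mean g * (mean h * 1))) by rewrite /c; ring.
rewrite -E; apply/eqP/eq_mean => u; rewrite !big_cons big_nil !eqxx orbT /=.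
rewrite (negPf pa) (negPf pb) (negPf pba) (eq_sym (p a) b) (negPf bpa) /= /Y.
by ring.
Qed.

Lemma mean_edge_sum : mean edge_sum = N * c.
Proof.
rewrite /edge_sum mean_sum (bigID (fun a => p a == a)) /= big1 ?add0r.
  rewrite (eq_bigr (fun _ => c)) => [|a pa]; last exact: mean_Y.
  by rewrite sumr_const -[LHS]mulr_natl /N cardsE.
move=> a /eqP pa; rewrite /mean big1 ?mul0r // => u _; by rewrite pa.
Qed.

(** Besides itself, an edge [a -> p a] meets only the edges that start at [p a]
    and at [p^-1 a]: the factor 3 counts these three correlated edges. *)
Lemma var_edge_sum : mean (fun u => (edge_sum u - N * c) ^+ 2) <= 3 * N * B * c.
Proof.
have XE u : edge_sum u = \sum_(a | p a != a) Y a u.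
  rewrite /edge_sum (bigID (fun a => p a == a)) /= big1 ?add0r //.
  by move=> a /eqP pa; rewrite pa.
have -> : mean (fun u => (edge_sum u - N * c) ^+ 2) =
    mean (fun u => edge_sum u ^+ 2) - (N * c) ^+ 2.
  rewrite (eq_mean (Y := fun u => edge_sum u ^+ 2 +
    ((- 2 * (N * c)) * edge_sum u + (N * c) ^+ 2))); last by move=> u; ring.
  rewrite !meanD meanZ mean_edge_sum mean_cst; first by ring.
  by rewrite card_ffun expn_gt0 L_gt0.
rewrite lerBlDr.
rewrite (eq_mean (Y := fun u => \sum_(a | p a != a) \sum_(b | p b != b) Y a u * Y b u)).
  rewrite mean_sum.
  have sumb a : p a != a ->
      mean (fun u => \sum_(b | p b != b) Y a u * Y b u) <= N * c ^+ 2 + 3 * B * c.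
    move=> pa; rewrite mean_sum.
    apply: (le_trans (ler_sum _ (fun b pb => mean_YY pa pb))).
    rewrite big_split /= sumr_const -[_ *+ _]mulr_natl -cardsE lerD2l -mulr_sumr.
    have c0 : 0 <= c by rewrite -(mean_Y pa); apply: mean_ge0.
    have B0 : 0 <= B.
      by case/card_gt0P: L_gt0 => x _; case/andP: (h0B x); apply: le_trans.
    rewrite -(mulrA 3) [leRHS]mulrC; apply: ler_wpM2l; first exact: mulr_ge0.
    rewrite !big_split /=.
    have le1 (q : pred I) (j : I) : (forall b, q b -> b = j) ->
        \sum_(b | p b != b) (q b)%:R <= 1 :> R.
      move=> qj; rewrite big_mkcond (bigD1 j) //= big1 => [|b bj].
        by rewrite addr0; case: ifP; case: (q j).
      by case: ifP => // _; case: (boolP (q b)) => // /qj /eqP; rewrite (negPf bj).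
    have -> : 3 = 1 + 1 + 1 :> R by ring.
    apply: lerD; first apply: lerD.
    - by apply: (le1 _ a) => b /eqP.
    - by apply: (le1 _ (p a)) => b /eqP.
    - by apply: (le1 _ (p^-1 a)%g) => b /eqP <-; rewrite permK.
  apply: (le_trans (ler_sum _ sumb)).
  rewrite sumr_const -[_ *+ _]mulr_natl -cardsE -/N le_eqVlt; apply/orP; left.
  by apply/eqP; ring.
by move=> u; rewrite XE expr2 mulr_suml; apply: eq_bigr => a _; rewrite mulr_sumr.
Qed.
End EdgeSum.
End FiniteMean.

(** * Online selection inside a pair of consecutive blocks *)

Section OnlineSelection.
Local Open Scope nat_scope.
Variables (n m W : nat).

Definition labelling := {ffun 'I_n -> 'I_m.+1 * 'I_W.+1}.

Definition block (u : labelling) a : nat := (u a).1.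

Definition value (u : labelling) a : nat := (u a).2.

(** Lexicographic rank of (block, value, index); the index breaks ties, so that
    keys are distinct for every labelling. *)
Definition key (u : labelling) (a : 'I_n) : nat :=
  (block u a * W.+1 + value u a) * n + a.

Lemma key_inj u : injective (key u).
Proof.
move=> a b /(congr1 (modn^~ n)); rewrite /key !modnMDl !modn_small //.
exact: val_inj.
Qed.

Lemma ltn_key_block u a b : block u a < block u b -> key u a < key u b.
Proof.
move=> ab; rewrite /key.
have va : value u a < W.+1 := ltn_ord _.
have : block u a * W.+1 + value u a < block u b * W.+1 + value u b by nia.
by have := ltn_ord a; nia.
Qed.

Lemma ltn_key_value u a b : block u a = block u b ->
  value u a < value u b -> key u a < key u b.
Proof. by move=> ab vab; rewrite /key ab; have := ltn_ord a; nia. Qed.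

Lemma eq_key (u v : labelling) a : u a = v a -> key u a = key v a.
Proof. by rewrite /key /block /value => ->. Qed.

Variables (p : 'S_n) (w k : nat).

Definition edge (u : labelling) a := (block u a == k) && (block u (p a) == k.+1).

(** Here the value of [p a] is read as the increment over the last accepted
    target; [selected] and [shift] are meant for labellings before [rotate]. *)
Definition selected (u : labelling) : {set 'I_n} :=
  [set a | edge u a && (value u (p a) < w)].

Definition shift (u : labelling) a : nat :=
  \sum_(b in selected u | key u b < key u a) (value u (p b)).+1.

(** Turns increments into absolute target values: every accepted increment
    [value u (p b)] moves the reference point by [(value u (p b)).+1], one more
    than the increment so that the chain is strict.  [shift u a] is the
    reference point when [a] is scanned, with values taken modulo [W.+1]. *)
Definition rotate (u : labelling) : labelling :=
  [ffun c => if edge u (p^-1 c)%g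
             then ((u c).1, inZp (value u c + shift u (p^-1 c)%g)) else u c].

Lemma block_rotate u c : block (rotate u) c = block u c.
Proof. by rewrite /block ffunE; case: ifP. Qed.

Lemma edge_rotate u a : edge (rotate u) a = edge u a.
Proof. by rewrite /edge !block_rotate. Qed.

Lemma rotate_out u c : block u c != k.+1 -> rotate u c = u c.
Proof. by move=> c_out; rewrite ffunE /edge permKV (negPf c_out) andbF. Qed.

Lemma key_rotate u a : edge u a -> key (rotate u) a = key u a.
Proof.
by case/andP=> /eqP ka _; apply: eq_key; rewrite rotate_out // ka neq_ltn ltnSn.
Qed.

Lemma value_rotate u a : edge u a ->
  value (rotate u) (p a) = (value u (p a) + shift u a) %% W.+1.
Proof. by move=> ea; rewrite /value ffunE permK ea. Qed.

(** The scan is reversible: blocks, and keys of sources, are untouched by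
    [rotate], so increments are recovered one by one in the order of the
    scan. *)
Lemma rotate_inj : injective rotate.
Proof.
move=> u v uv.
have block_uv c : block u c = block v c by rewrite -block_rotate uv block_rotate.
have edge_uv a : edge u a = edge v a by rewrite -edge_rotate uv edge_rotate.
have key_uv a : edge u a -> key u a = key v a.
  by move=> ea; rewrite -key_rotate // uv key_rotate // -edge_uv.
have value_uv N : forall a, edge u a -> key u a < N ->
    value u (p a) = value v (p a).
  elim: N => // N IHN a ea kaN.
  have shift_uv : shift u a = shift v a.
    apply: eq_big => [b|b].
      rewrite !inE -edge_uv; case eb: (edge u b) => //=.
      rewrite -!key_uv // ![(value _ _ < w) && _]andbC.
      case: ltnP => //= ba; rewrite IHN // (leq_trans ba) //.
    rewrite inE => /andP[/andP[eb _] ba]; rewrite IHN // (leq_trans ba) //.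
  have := congr1 (fun x => value x (p a)) uv.
  rewrite !value_rotate -?edge_uv // shift_uv => /eqP.
  by rewrite eqn_modDr !modn_small ?ltn_ord // => /eqP.
apply/ffunP => c; case: (boolP (edge u (p^-1 c)%g)) => [ec|nec].
  have := value_uv _ _ ec (ltnSn _); rewrite permKV => vc.
  by rewrite [u c]surjective_pairing [v c]surjective_pairing; congr (_, _);
    apply: val_inj => //; apply: block_uv.
have := congr1 (fun x : labelling => x c) uv.
by rewrite !ffunE -edge_uv (negPf nec).
Qed.

(** Under this bound no target value wraps around modulo [W.+1], so the
    reference point, hence the accepted target values, only increase. *)
Lemma selected_chain u :
    \sum_(b in selected u) (value u (p b)).+1 <= W.+1 ->
  {in selected u &, forall a b, key (rotate u) a < key (rotate u) b ->
     key (rotate u) (p a) < key (rotate u) (p b)}.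
Proof.
move=> le_W.
have value_sel a : a \in selected u ->
    value (rotate u) (p a) = value u (p a) + shift u a.
  rewrite inE => /andP[ea va]; rewrite value_rotate // modn_small //.
  apply: leq_trans le_W; rewrite (bigD1 a) /=; last by rewrite inE ea.
  rewrite addSn ltnS leq_add2l /shift [leqLHS]big_mkcond [leqRHS]big_mkcond /=.
  apply: leq_sum => b _; case: ifP => // /andP[-> ba].
  by case: eqP ba => // ->; rewrite ltnn.
have shift_lt a b : a \in selected u -> key u a < key u b ->
    value u (p a) + shift u a < shift u b.
  move=> sa ab; rewrite {2}/shift (bigD1 a) /=; last by rewrite sa.
  rewrite addSn ltnS leq_add2l /shift [leqLHS]big_mkcond [leqRHS]big_mkcond /=.
  apply: leq_sum => c _; case: ifP => // /andP[-> ca].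
  by rewrite (ltn_trans ca ab) /=; case: eqP ca => // ->; rewrite ltnn.
move=> a b sa sb.
have := sa; have := sb; rewrite !inE => /andP[eb _] /andP[ea _].
rewrite (key_rotate ea) (key_rotate eb) => ab; apply: ltn_key_value.
  by rewrite !block_rotate; case/andP: ea => _ /eqP->; case/andP: eb => _ /eqP->.
by rewrite !value_sel // (leq_trans (shift_lt _ _ sa ab)) // leq_addl.
Qed.
End OnlineSelection.

(** * Probability that the selection fails *)

Section SelectionProbability.
Variables (R : realFieldType) (n m W q : nat) (p : 'S_n) (k : nat).
Hypotheses (W_def : W.+1 = (q * q)%N) (k_lt : (k < m)%N).

Let M : R := m.+1%:R.
Let Q : R := q%:R.
Let N : R := #|[set a | p a != a]|%:R.

Let label : Type := ('I_m.+1 * 'I_W.+1)%type.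
Let g (x : label) : R := (x.1 == k :> nat)%:R.
Let h (F : nat -> R) (x : label) : R :=
  (x.1 == k.+1 :> nat)%:R * ((x.2 < q)%:R * F x.2).

Let q_gt0 : (0 < q)%N.
Proof. by case: q W_def. Qed.

Let Q_gt0 : 0 < Q.
Proof. by rewrite ltr0n. Qed.

Let M_gt0 : 0 < M.
Proof. by rewrite ltr0n. Qed.

Let Q_neq0 : q%:R != 0 :> R.
Proof. by rewrite gt_eqF. Qed.

Let M_neq0 : 1 + m%:R != 0 :> R.
Proof. by rewrite addrC natr1 gt_eqF. Qed.

Let mean_g : mean g = M^-1.
Proof.
rewrite (eq_mean (Y := fun x : label => (x.1 == k :> nat)%:R * 1)); last first.
  by move=> x; rewrite mulr1.
rewrite (mean_pair (fun x : 'I_m.+1 => (x == k :> nat)%:R) (fun _ : 'I_W.+1 => 1)).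
have k_lt' : (k < m.+1)%N by apply: leqW.
rewrite (mean_ord_eq _ k_lt') (mean_cst (T := 'I_W.+1) 1) ?mulr1 //.
by rewrite card_ord.
Qed.

Let mean_h F : mean (h F) = M^-1 * ((\sum_(y < q) F y) / (Q * Q)).
Proof.
rewrite (mean_pair (fun x : 'I_m.+1 => (x == k.+1 :> nat)%:R)
  (fun y : 'I_W.+1 => (y < q)%:R * F y)).
have q_le : (q <= W.+1)%N by rewrite W_def leq_pmull.
by rewrite (mean_ord_eq _ (k_lt : k.+1 < m.+1)%N) mean_ord_lt // W_def natrM.
Qed.

Let edge_sum_selected F (u : labelling n m W) :
  edge_sum p g (h F) u = \sum_(a in selected p q k u) F (value u (p a)).
Proof.
rewrite [RHS]big_mkcond; apply: eq_bigr => a _; rewrite inE /edge /g /h.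
by do 3!case: (_ == _) || case: (_ < _)%N; rewrite /= ?mul1r ?mul0r ?mulr0.
Qed.

(** The window is [q] and there are [q * q] values, so that [c] is the mean
    contribution of an edge. *)
Let selected_chebyshev (F : nat -> R) (B t : R) (P : pred (labelling n m W)) :
    let c := (\sum_(y < q) F y) / (M ^+ 2 * Q ^+ 2) in
    (forall y : nat, (y < q)%N -> 0 <= F y <= B) -> 0 < t ->
    (forall u, P u ->
      t <= `|\sum_(a in selected p q k u) F (value u (p a)) - N * c|) ->
  freq R P <= 3 * N * B * c / t ^+ 2.
Proof.
move=> c F0B t0 PF.
have L0 : (0 < #|{: label}|)%N by rewrite card_prod !card_ord.
have B0 : 0 <= B by case/andP: (F0B 0%N q_gt0); apply: le_trans.
have cE : c = mean g * mean (h F).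
  rewrite mean_g mean_h /c; field.
  by rewrite ?Q_neq0 ?M_neq0 ?gt_eqF.
apply: (chebyshev_mean (X := edge_sum p g (h F)) (c := N * c)) => //.
  rewrite cE; apply: var_edge_sum => // x.
  - by rewrite /g; case: (_ == _); rewrite ?lexx ?ler01.
  - rewrite /h; case: (_ == _); rewrite ?mul0r ?lexx ?B0 // mul1r.
    by case: ltnP => [/F0B|_]; rewrite ?mul1r // mul0r lexx.
  - rewrite /g /h; case: eqP => [->|_]; rewrite ?mul0r //.
    by rewrite mul1r (ltn_eqF (ltnSn k)) mul0r.
by move=> u /PF; rewrite edge_sum_selected.
Qed.

(** Chebyshev around the mean number [N / (M ^+ 2 * Q)] of selected points,
    which the hypothesis makes at least [Q / 2]. *)
Lemma freq_few_selected (d : R) : 0 < d -> M ^+ 2 * Q ^+ 2 <= 2 * N ->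
  freq R (fun u : labelling n m W =>
    #|selected p q k u|%:R < (1 - d) * (N / (M ^+ 2 * Q))) <= 6 / d ^+ 2 / Q.
Proof.
move=> d0 N_large.
have N0 : 0 < N.
  by rewrite -(pmulr_rgt0 _ (@ltr0Sn R 1)) (lt_le_trans _ N_large) // mulr_gt0 ?exprn_gt0.
pose e := N / (M ^+ 2 * Q).
have e0 : 0 < e by rewrite divr_gt0 ?mulr_gt0 ?exprn_gt0.
have Qe : Q <= 2 * e.
  by rewrite /e mulrA ler_pdivlMr ?mulr_gt0 ?exprn_gt0 // mulrCA -expr2.
have cE : N * ((\sum_(y < q) (1 : R)) / (M ^+ 2 * Q ^+ 2)) = e.
  rewrite sumr_const card_ord /e -[1 *+ q]/Q.
  by field; rewrite ?Q_neq0 ?M_neq0 ?gt_eqF.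
have -> : 6 / d ^+ 2 / Q = 3 * e * 2 / (d ^+ 2 * (e * Q)).
  by field; rewrite ?Q_neq0 ?M_neq0 ?gt_eqF.
apply: (@le_trans _ _ (3 * N * 1 * ((\sum_(y < q) (1 : R)) / (M ^+ 2 * Q ^+ 2)) / (d * e) ^+ 2)).
  apply: (selected_chebyshev (F := fun _ => 1)).
  - by move=> *; rewrite ler01 lexx.
  - exact: mulr_gt0.
  move=> u; rewrite cE sumr_const -/e => /ltW.
  rewrite mulrBl mul1r lerBrDl => le_e.
  by rewrite ler_normr; apply/orP; right; rewrite opprB lerBrDr.
rewrite mulr1 -(mulrA 3 N) cE.
have -> : 3 * e * 2 / (d ^+ 2 * (e * Q)) = 3 * e / (d * e) ^+ 2 * (2 * e / Q).
  by field; rewrite ?Q_neq0 ?M_neq0 ?gt_eqF.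
rewrite ler_peMr //.
  by apply: divr_ge0; [apply: mulr_ge0 => //; apply: ltW | apply: sqr_ge0].
by rewrite ler_pdivlMr // mul1r.
Qed.

(** The hypothesis on [N] caps the mean total increment at 8 / 9 of
    [Q * (Q + 1)], which leaves a gap of at least [Q ^+ 2 / 18] to the number
    [Q ^+ 2] of values; the variance is at most 3 * (16 / 9) * Q ^+ 3, and
    1728 = 3 * (16 / 9) * 18 ^ 2. *)
Lemma freq_selected_wraps : (16 <= q)%N -> 9 * N <= 16 * (M ^+ 2 * Q ^+ 2) ->
  freq R (fun u : labelling n m W =>
    (W.+1 < \sum_(a in selected p q k u) (value u (p a)).+1)%N) <= 1728 / Q.
Proof.
move=> q16 N_small.
have Q16 : 16 <= Q by rewrite (ler_nat _ 16).
pose e := N * ((\sum_(y < q) y.+1%:R) / (M ^+ 2 * Q ^+ 2)).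
have eE : e = N / (M ^+ 2 * Q ^+ 2) * (Q * (Q + 1) / 2).
  rewrite /e sum_succ -/Q; field.
  by rewrite ?Q_neq0 ?M_neq0 ?gt_eqF.
have Nle : N / (M ^+ 2 * Q ^+ 2) <= 16 / 9.
  rewrite ler_pdivrMr ?mulr_gt0 ?exprn_gt0 //; lra.
have e_le : e <= 8 / 9 * (Q * (Q + 1)).
  rewrite eE; have -> : 8 / 9 * (Q * (Q + 1)) = 16 / 9 * (Q * (Q + 1) / 2) by field.
  by apply: ler_wpM2r => //; nra.
apply: (@le_trans _ _ (3 * N * Q * ((\sum_(y < q) y.+1%:R) / (M ^+ 2 * Q ^+ 2)) /
    (Q ^+ 2 / 18) ^+ 2)).
  apply: (selected_chebyshev (F := fun y => y.+1%:R)).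
  - by move=> y yq; rewrite ler0n ler_nat.
  - by rewrite divr_gt0 ?exprn_gt0.
  move=> u; rewrite -(ltr_nat R) W_def natrM natr_sum -/e -/Q => wraps.
  apply: le_trans (ler_norm _); nra.
have -> : 3 * N * Q * ((\sum_(y < q) y.+1%:R) / (M ^+ 2 * Q ^+ 2)) = 3 * Q * e.
  by rewrite /e; ring.
rewrite ler_pdivrMr ?exprn_gt0 ?divr_gt0 ?exprn_gt0 //.
have -> : 1728 / Q * (Q ^+ 2 / 18) ^+ 2 = 3 * Q * (16 / 9 * Q ^+ 2).
  by field; rewrite ?Q_neq0.
rewrite ler_pM2l; last by rewrite mulr_gt0.
nra.
Qed.
End SelectionProbability.

(** * Concatenating the chains of all pairs of consecutive blocks *)

Section Concatenation.
Variables (R : realFieldType) (n m W : nat) (p : 'S_n).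

Definition long_chain (a0 : R) (k : nat) (u : labelling n m W)
    (C : {set 'I_n}) : bool :=
  [&& a0 <= #|C|%:R, [forall a in C, edge p k u a] &
    [forall a in C, forall b in C,
       (key u a < key u b)%N ==> (key u (p a) < key u (p b))%N]].

(** Sources and targets of the [k]-th chain lie in blocks [k] and [k.+1], so
    both come before those of the [l]-th chain when [k < l]. *)
Lemma LIS_ge_concat (a0 : R) (t : 'S_n) (u : labelling n m W) :
    (forall a b, (t a < t b)%N = (key u a < key u b)%N) ->
    (forall k : 'I_m, exists C, long_chain a0 k u C) ->
  m%:R * a0 <= (LIS (t^-1 * p * t)%g)%:R.
Proof.
move=> tP /fin_all_exists[C CP].
have edgeC (k : 'I_m) a : a \in C k -> edge p k u a.
  by case/and3P: (CP k) => _ /forall_inP + _; apply.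
have disjC (k l : 'I_m) : k != l -> [disjoint C k & C l].
  move=> kl; rewrite disjoint_subset; apply/fintype.subsetP => a aCk; rewrite inE.
  apply: contra kl => aCl; apply/eqP/val_inj => /=.
  by case/andP: (edgeC _ _ aCk) => /eqP <- _; case/andP: (edgeC _ _ aCl) => /eqP.
pose D := \bigcup_(k in predT) C k.
have cardD : #|D| = (\sum_(k < m) #|C k|)%N.
  rewrite -sum1_card /D partition_disjoint_bigcup //=.
  by apply: eq_bigr => k _; rewrite sum1_card.
apply: (@le_trans _ _ #|D|%:R).
  rewrite cardD natr_sum -[m in m%:R]card_ord mulr_natl -sumr_const.
  by apply: ler_sum => k _; case/and3P: (CP k).
rewrite ler_nat; apply: LIS_conj_ge_chain => a b.
move=> /bigcupP[k _ aCk] /bigcupP[l _ bCl]; rewrite !tP => ab.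
have /andP[/eqP ka /eqP pka] := edgeC _ _ aCk.
have /andP[/eqP lb /eqP plb] := edgeC _ _ bCl.
case: (ltngtP k l) => [kl|lk|/val_inj kl].
- by apply: ltn_key_block; rewrite pka plb.
- have : (key u b < key u a)%N by apply: ltn_key_block; rewrite ka lb.
  by rewrite ltnNge ltnW.
- case/and3P: (CP k) => _ _ /forall_inP/(_ a aCk)/forall_inP/(_ b).
  by rewrite kl => /(_ bCl)/implyP; apply.
Qed.

Variable q : nat.
Hypothesis W_def : W.+1 = (q * q)%N.
Let M : R := m.+1%:R.
Let Q : R := q%:R.
Let N : R := #|[set a | p a != a]|%:R.

(** As [rotate] is a bijection, the frequency may be computed on rotated
    labellings, where a successful selection is a long chain. *)
Lemma freq_no_long_chain (d : R) (k : 'I_m) : 0 < d -> (16 <= q)%N ->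
    M ^+ 2 * Q ^+ 2 <= 2 * N -> 9 * N <= 16 * (M ^+ 2 * Q ^+ 2) ->
  freq R (fun u => ~~ [exists C, long_chain ((1 - d) * (N / (M ^+ 2 * Q))) k u C])
    <= (6 / d ^+ 2 + 1728) / Q.
Proof.
move=> d0 q16 N_large N_small; rewrite [leRHS]mulrDl.
rewrite -(freq_bij R _ (@rotate_inj n m W p q k)).
apply: le_trans (lerD (freq_few_selected W_def (ltn_ord k) d0 N_large)
                      (freq_selected_wraps W_def (ltn_ord k) q16 N_small)).
apply: le_trans (freq_or R _ _); apply: freq_le => u.
apply: contraR; rewrite negb_or -leNgt -leqNgt => /andP[many no_wrap].
apply/existsP; exists (selected p q k u); apply/and3P; split => //.
  by apply/forall_inP => a; rewrite inE edge_rotate => /andP[].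
apply/forall_inP => a aS; apply/forall_inP => b bS; apply/implyP.
exact: selected_chain.
Qed.

Lemma freq_LIS_conj_small (t : labelling n m W -> 'S_n) (d : R) :
    (forall u a b, (t u a < t u b)%N = (key u a < key u b)%N) ->
    0 < d -> (16 <= q)%N ->
    M ^+ 2 * Q ^+ 2 <= 2 * N -> 9 * N <= 16 * (M ^+ 2 * Q ^+ 2) ->
  freq R (fun u => (LIS ((t u)^-1 * p * t u)%g)%:R <
                   m%:R * ((1 - d) * (N / (M ^+ 2 * Q))))
    <= m%:R * ((6 / d ^+ 2 + 1728) / Q).
Proof.
move=> tP d0 q16 N_large N_small.
pose a0 := (1 - d) * (N / (M ^+ 2 * Q)).
apply: (@le_trans _ _
    (\sum_(k < m) freq R (fun u => ~~ [exists C, long_chain a0 k u C]))).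
  apply: le_trans (freq_exists R _); apply: freq_le => u.
  apply: contraTT; rewrite negb_exists -leNgt => /forallP good.
  apply: LIS_ge_concat; first exact: tP.
  by move=> k; apply/existsP; have := good k; rewrite negbK.
rewrite -[m in m%:R]card_ord mulr_natl -sumr_const.
by apply: ler_sum => k _; apply: freq_no_long_chain.
Qed.
End Concatenation.

Lemma exists_relabelling (n m W : nat) : exists t : labelling n m W -> 'S_n,
  forall u a b, (t u a < t u b)%N = (key u a < key u b)%N.
Proof.
by have /fin_all_exists[t tP] := fun u => perm_of_key (@key_inj n m W u); exists t.
Qed.

(** * Relabellings for large n *)

Section RandomRelabelling.
Variable R : realType.

(** Numerator left when, in the bound of [freq_LIS_conj_small] for [m = 64] and
    [d = 1 / 64], [q] is replaced by its lower bound 3 / 260 * sqrt n. *)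
Definition failure_bound : R :=
  64 * (6 / (1 / 64) ^+ 2 + 1728) * (260 / 3).

Lemma failure_bound_gt0 : 0 < failure_bound.
Proof. by rewrite /failure_bound; lra. Qed.

(** The relabelling is drawn uniformly from a finite type, and the same choice
    works for every [p]: this uniformity allows averaging over a random [p]. *)
Lemma freq_LIS_conj_le (n : nat) : 2700 <= Num.sqrt n%:R :> R ->
  exists (T : finType) (t : T -> 'S_n), (0 < #|T|)%N /\ forall p : 'S_n,
    freq R (fun u => (LIS ((t u)^-1 * p * t u)%g)%:R <= 5 / 4 * Num.sqrt n%:R :> R)
      <= failure_bound / Num.sqrt n%:R.
Proof.
set s := Num.sqrt n%:R => s_large.
have nE : n%:R = s * s by rewrite -expr2 sqr_sqrtr ?ler0n.
(* q is about sqrt n / (gamma * 65) with gamma = 4 / 3; rounding up keeps the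
   total increment below the number of values. *)
pose q := (Num.trunc (3 * s / 260)).+1.
have /andP[q_ge q_lt] : q%:R - 1 <= 3 * s / 260 < q%:R.
  have /andP[] : (Num.trunc (3 * s / 260))%:R <= 3 * s / 260 < q%:R.
    by apply: truncn_itv; lra.
  have -> : q%:R = (Num.trunc (3 * s / 260))%:R + 1 :> R by rewrite natr1.
  by rewrite addrK => -> ->.
have q16 : (16 <= q)%N by rewrite -(ler_nat R); lra.
have W_def : (q * q).-1.+1 = (q * q)%N by rewrite prednK // muln_gt0 /q.
have [t tP] := exists_relabelling n 64 (q * q).-1.
exists _, t; split; first by rewrite card_ffun card_prod !card_ord expn_gt0 W_def.
move=> p.
set F := (#|[set a | p a == a]|)%N.
have FN : F%:R + #|[set a | p a != a]|%:R = s * s.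
  rewrite -nE -natrD /F -[n in RHS]card_ord -(cardC [pred a | p a == a]).
  by rewrite !cardsE; congr (_ + _)%:R; apply: eq_card => a; rewrite !inE.
(* Many fixed points already form a long chain, for every relabelling. *)
have [many|few] := ltP (5 / 4 * s) F%:R.
  rewrite /freq /mean big1 ?mul0r; first by rewrite divr_ge0 ?sqrtr_ge0 ?ltW ?failure_bound_gt0.
  move=> u _; apply/eqP; rewrite pnatr_eq0 eqb0 -ltNge (lt_le_trans many) // ler_nat.
  by apply: LIS_conj_ge_chain => a b; rewrite !inE => /eqP-> /eqP->.
set N := #|_|%:R in FN; set Q := q%:R in q_ge q_lt.
have Q_gt0 : 0 < Q by lra.
have F_ge0 : 0 <= F%:R :> R by exact: ler0n.
have N_large : 65%:R ^+ 2 * Q ^+ 2 <= 2 * N by nra.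
have N_small : 9 * N <= 16 * (65%:R ^+ 2 * Q ^+ 2) by nra.
have bound (C : R) : 0 < C -> 64 * (C / Q) <= 64 * C * (260 / 3) / s.
  move=> C_gt0; rewrite mulrA -[leRHS]mulrA; apply: ler_wpM2l; first by lra.
  by rewrite ler_pdivlMr ?[_^-1 * s]mulrC ?ler_pdivrMr //; lra.
have C_gt0 : 0 < 6 / (1 / 64) ^+ 2 + 1728 :> R by lra.
have threshold : 5 / 4 * s < 64 * ((1 - 1 / 64) * (N / (65%:R ^+ 2 * Q))).
  have -> : 64 * ((1 - 1 / 64) * (N / (65%:R ^+ 2 * Q))) = 63 * N / (65 ^+ 2 * Q).
    by field; rewrite gt_eqF.
  rewrite ltr_pdivlMr; first by nra.
  by rewrite mulr_gt0 ?exprn_gt0.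
have d_gt0 : 0 < 1 / 64 :> R by lra.
apply: le_trans (bound _ C_gt0).
apply: le_trans (freq_LIS_conj_small W_def tP d_gt0 q16 N_large N_small).
by apply: freq_le => u /= small; apply: le_lt_trans small threshold.
Qed.
End RandomRelabelling.

(** * From relabellings to conjugation invariant random permutations *)

Local Open Scope classical_set_scope.

Section Averaging.
Variables (R : realType) (d : measure_display) (T : measurableType d).
Variables (P : probability T R) (n : nat) (X : {RV P >-> 'S_n}).

Lemma measurable_RV_perm (A : set 'S_n) : measurable (X @^-1` A).
Proof. by apply: measurable_funPTI. Qed.

Lemma prob_RV_perm (B : pred 'S_n) :
  P [set w | B (X w)] = (\sum_(p | B p) P (X @^-1` [set p]))%E.
Proof.
have -> : [set w | B (X w)] = \bigcup_(p in [set` B]) (X @^-1` [set p]).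
  apply/seteqP; split => [w Bw|w [p Bp /= Xp]]; first by exists (X w).
  by rewrite Xp.
rewrite measure_fin_bigcup //.
- rewrite -(@bigfs _ _ _ _ (index_enum _)) ?index_enum_uniq //.
  by move=> p _; rewrite mem_index_enum.
- by move=> p q _ _ [w []] /= -> .
- by move=> p _; exact: measurable_RV_perm.
Qed.

(** The event has the same probability for [X] and for each conjugate of [X]
    by [t u]; averaging over [u] first, with the value of [X] fixed, bounds
    it by [c]. *)
Lemma prob_le_of_freq_conj (U : finType) (t : U -> 'S_n) (B : pred 'S_n) (c : R) :
    (forall s : 'S_n, pushforward P (fun w => (s^-1 * X w * s)%g) =
                      distribution P X) ->
    (0 < #|U|)%N ->
    (forall p : 'S_n, freq R (fun u => B ((t u)^-1 * p * t u)%g) <= c) ->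
  (P [set w | B (X w)] <= c%:E)%E.
Proof.
move=> X_inv U0 freq_c.
pose mu p : R := fine (P (X @^-1` [set p])).
have muE p : P (X @^-1` [set p]) = (mu p)%:E.
  by rewrite fineK // fin_num_measure //; exact: measurable_RV_perm.
have mu_ge0 p : 0 <= mu p by rewrite fine_ge0.
have prE (C : pred 'S_n) : P [set w | C (X w)] = (\sum_(p | C p) mu p)%:E.
  by rewrite prob_RV_perm -sumEFin; apply: eq_bigr => p _; rewrite muE.
have mu1 : \sum_p mu p = 1.
  apply: EFin_inj; rewrite -(prE predT) -[RHS](probability_setT P).
  by congr (P _); apply/seteqP.
have conjE u : \sum_(p | B p) mu p = \sum_(p | B ((t u)^-1 * p * t u)%g) mu p.
  apply: EFin_inj; rewrite -!prE.
  by have := congr1 (fun m => m [set p | B p]) (X_inv (t u)).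
rewrite prE lee_fin -(mean_cst (T := U) (\sum_(p | B p) mu p)) //.
rewrite (eq_mean conjE).
rewrite (eq_mean (Y := fun u => \sum_p mu p * (B ((t u)^-1 * p * t u)%g)%:R)).
  rewrite mean_sum; apply: (@le_trans _ _ (\sum_p mu p * c)); last first.
    by rewrite -mulr_suml mu1 mul1r.
  apply: ler_sum => p _.
  by rewrite meanZ; apply: ler_wpM2l; [exact: mu_ge0 | exact: freq_c].
move=> u; rewrite big_mkcond; apply: eq_bigr => p _.
by case: ifP; rewrite ?mulr1 ?mulr0.
Qed.

Lemma prob_mul_le_expectation (f : 'S_n -> R) (a : R) :
  0 <= a -> (forall p, 0 <= f p) ->
  (a%:E * P [set w | (a < f (X w))%R] <= 'E_P[fun w => f (X w)])%E.
Proof.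
move=> a0 f0; set A := [set w | _].
have mA : measurable A by exact: (measurable_RV_perm [set p | a < f p]).
have mf : measurable_fun setT (f \o X).
  by apply: measurableT_comp => // _ Y _; rewrite setTI.
have mA1 : measurable_fun setT (fun w => (\1_A w)%:E : \bar R).
  exact/measurable_EFinP/measurable_indic.
rewrite unlock -[A]setIT -integral_indic // -ge0_integralZl //.
apply: ge0_le_integral => //.
- by move=> w _; rewrite mule_ge0 // lee_fin.
- by apply: measurable_funeM.
- exact/measurable_EFinP.
- move=> w _; rewrite -EFinM lee_fin indicE.
  by case: (boolP (w \in A)) => [|_]; rewrite ?mulr1 ?mulr0 // inE => /ltW.
Qed.
End Averaging.

(** * Limits *)

Lemma limn_einf_ge (R : realType) (u : (\bar R)^nat) (c : \bar R) :
  (\forall n \near \oo, (c <= u n)%E) -> (c <= limn_einf u)%E.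
Proof.
move=> [N _ cu]; rewrite limn_einf_lim; apply: lime_ge; first exact: is_cvg_einfs.
exists N => // m /= Nm; apply: le_ereal_inf_tmp => _ [k /= mk <-].
by apply: cu; apply: leq_trans mk.
Qed.

Lemma near_le_sqrtn (R : realType) (A : R) :
  \forall n \near \oo, A <= Num.sqrt n%:R.
Proof.
near=> n; rewrite (le_trans (ler_norm A)) // -sqrtr_sqr ler_wsqrtr //.
near: n; exact: nbhs_infty_ger.
Unshelve. all: by end_near. Qed.

Lemma sqrt13_lt (R : realType) : 2 * Num.sqrt 13 - 6 < 61 / 50 :> R.
Proof.
suff : Num.sqrt 13 < 361 / 100 :> R by lra.
rewrite -ltr_sqr ?nnegrE ?sqrtr_ge0 ?sqr_sqrtr //; lra.
Qed.

Section ConjugationInvariant.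
Variables (R : realType) (d : nat -> measure_display).
Variables (T : forall n, measurableType (d n)) (P : forall n, probability (T n) R).
Variable (sigma : forall n, {RV (P n) >-> 'S_n}).
Hypothesis sigma_inv : conjugation_invariant sigma.

Let LIS_above n := [set w | (5 / 4 * Num.sqrt n%:R < (LIS (sigma n w))%:R :> R)].

Lemma prob_LIS_above n : 2700 <= Num.sqrt n%:R :> R ->
  ((1 - failure_bound R / Num.sqrt n%:R)%:E <= P n (@LIS_above n))%E.
Proof.
move=> s_large.
have n0 : (0 < n)%N by case: n s_large => //; rewrite sqrtr0; lra.
have [U [t [U0 freq_t]]] := freq_LIS_conj_le s_large.
have := prob_le_of_freq_conj (B := fun p => (LIS p)%:R <= 5 / 4 * Num.sqrt n%:R :> R)
  (fun s => @sigma_inv n s n0) U0 freq_t.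
have -> : @LIS_above n =
    ~` [set w | (LIS (sigma n w))%:R <= 5 / 4 * Num.sqrt n%:R :> R].
  by apply/seteqP; split => w; rewrite /LIS_above /= ltNge => /negP.
set A := [set w | _] => PA.
have mA : measurable A.
  exact: (measurable_RV_perm (sigma n)
    [set p : 'S_n | (LIS p)%:R <= 5 / 4 * Num.sqrt n%:R :> R]).
by rewrite probability_setC // EFinB leeB.
Qed.

Lemma cvg_prob_LIS (c : R) : c <= 5 / 4 ->
  (fun n => P n [set w | c * Num.sqrt n%:R < (LIS (sigma n w))%:R]) @ \oo --> 1%:E.
Proof.
move=> c_le.
apply: (@squeeze_cvge _ _ _ _ (fun n => (1 - failure_bound R / Num.sqrt n%:R)%:E)
  _ (fun=> 1%:E)); last exact: cvg_cst.
  near=> n; apply/andP; split; last first.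
    by apply: probability_le1; exact: (measurable_RV_perm (sigma n)
      [set p : 'S_n | c * Num.sqrt n%:R < (LIS p)%:R]).
  apply: (@le_trans _ _ (P n (@LIS_above n))).
    apply: prob_LIS_above; near: n; exact: near_le_sqrtn.
  apply: le_measure; rewrite ?inE.
  - exact: (measurable_RV_perm (sigma n)
      [set p : 'S_n | 5 / 4 * Num.sqrt n%:R < (LIS p)%:R]).
  - exact: (measurable_RV_perm (sigma n)
      [set p : 'S_n | c * Num.sqrt n%:R < (LIS p)%:R]).
  - by move=> w; apply: le_lt_trans; rewrite ler_wpM2r ?sqrtr_ge0.
apply: cvg_EFin; first by near=> n.
rewrite -[X in _ --> X]subr0; apply: cvgB; first exact: cvg_cst.
apply/cvgrPdist_le => e e0; near=> n.
have : failure_bound R / e <= Num.sqrt n%:R by near: n; exact: near_le_sqrtn.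
have Ke : 0 < failure_bound R / e by rewrite divr_gt0 ?failure_bound_gt0.
move=> s_large; have s0 := lt_le_trans Ke s_large.
rewrite sub0r normrN ger0_norm; last first.
  by rewrite divr_ge0 ?ltW ?failure_bound_gt0.
by rewrite ler_pdivrMr // mulrC -ler_pdivrMr.
Unshelve. all: by end_near. Qed.

(** Markov's inequality at 5 / 4 * sqrt n; the gap between [c] and 5 / 4 absorbs
    the probability of failure. *)
Lemma limn_einf_expectation_LIS (c : R) : 0 <= c < 5 / 4 ->
  (c%:E <= limn_einf (fun n => 'E_(P n)[fun w => ((LIS (sigma n w))%:R : R)]
                         / (Num.sqrt n%:R : R)%:E))%E.
Proof.
move=> /andP[c0 c_lt]; apply: limn_einf_ge; near=> n.
have s1 : 2700 <= Num.sqrt n%:R :> R by near: n; exact: near_le_sqrtn.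
have s2 : failure_bound R * (5 / 4) / (5 / 4 - c) <= Num.sqrt n%:R.
  by near: n; exact: near_le_sqrtn.
set s := Num.sqrt n%:R in s1 s2 *.
have s0 : 0 < s by lra.
rewrite inver gt_eqF // lee_pdivlMr // -EFinM.
have s54 : 0 <= 5 / 4 * s by lra.
apply: le_trans (prob_mul_le_expectation (sigma n) s54 (fun p => ler0n R (LIS p))).
apply: le_trans (lee_wpmul2l _ (prob_LIS_above s1)).
  rewrite -EFinM lee_fin mulrAC; apply: ler_wpM2r; first exact: ltW.
  move: s2; rewrite ler_pdivrMr ?subr_gt0 // => s2.
  rewrite mulrBr mulr1 lerBrDl -lerBrDr mulrCA mulrA ler_pdivrMr //.
  by rewrite [leRHS]mulrC.
by rewrite lee_fin.
Unshelve. all: by end_near. Qed.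
End ConjugationInvariant.

Theorem proposition38 (R : realType) (d : nat -> measure_display)
    (T : forall n, measurableType (d n)) (P : forall n, probability (T n) R)
    (sigma : forall n, {RV (P n) >-> 'S_n})
    (sigma_inv : conjugation_invariant sigma) :
  (forall eps : R, 0 < eps ->
     (fun n => P n [set w | (2 * Num.sqrt 13 - 6 - eps) * Num.sqrt n%:R
                            < (LIS (sigma n w))%:R])
       @ \oo --> 1%:E) /\
  ((2 * Num.sqrt 13 - 6)%:E <=
     limn_einf (fun n => 'E_(P n)[fun w => ((LIS (sigma n w))%:R : R)]
                         / (Num.sqrt n%:R : R)%:E))%E.
Proof.
have := sqrt13_lt R => lt13; split => [eps eps0|].
  by apply: cvg_prob_LIS => //; lra.
apply: le_trans (limn_einf_expectation_LIS sigma_inv (c := 61 / 50) _).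
  by rewrite lee_fin ltW.
by apply/andP; split; lra.
Qed.
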